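(* Let $P\subset N_{\mathbb{Q}}$ be a symmetric Fano polygon. Then $P$ is minimal.
   Context: Let $N\cong\mathbb{Z}^2$, $M=\mathrm{Hom}(N,\mathbb{Z})$, $N_{\mathbb{Q}}=N\otimes\mathbb{Q}$. A convex lattice polygon $P\subset N_{\mathbb{Q}}$ is Fano if the origin lies in its strict interior and every vertex $(x,y)$ satisfies $\gcd(x,y)=1$. With $\mathrm{Aut}(P)=\{G\in \mathrm{GL}_2(\mathbb{Z}) : GP=P\}$, $P$ is symmetric if the only point of $N_{\mathbb{Q}}$ fixed by all of $\mathrm{Aut}(P)$ is $0$. Mutation: let $P$ be a Fano polygon and $w\in M$ primitive. Put $h_{\min}=\min_{x\in P}w(x)$, $h_{\max}=\max_{x\in P}w(x)$. For an integer $h$ let $N_h=\{x\in N: w(x)=h\}$, $P_h=\mathrm{conv}(P\cap N_h)$, and let $\mathcal{V}(P)_h$ be the set of vertices of $P$ lying in $N_h$. A lattice polytope $F\subset N_{\mathbb{Q}}$ is a factor of $P$ with respect to $w$ if $w(F)=\{0\}$ and for every integer $h$ with $h_{\min}\le h<0$ there is a (possibly empty) lattice polytope $R_h\subset N_{\mathbb{Q}}$ with $\mathcal{V}(P)_h\subseteq R_h+|h|F\subseteq P_h$. The mutation of $P$ with respect to $w$ and $F$ is $\mathrm{mut}_w(P,F)=\mathrm{conv}\big(\bigcup_{h=h_{\min}}^{-1}R_h\cup\bigcup_{h=0}^{h_{\max}}(P_h+hF)\big)$ (it does not depend on the choice of the $R_h$). A Fano polygon $P$ is minimal if $|\partial P\cap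 N|\le|\partial Q\cap N|$ for every mutation $Q=\mathrm{mut}_w(P,F)$ of $P$. *)

(* Defs.v *)
From mathcomp Require Import all_boot all_order all_algebra.
From mathcomp Require Import all_classical.
From mathcomp Require Import topology normedtype convex.
Set Implicit Arguments.
Unset Strict Implicit.
Unset Printing Implicit Defensive.
Import Order.TTheory GRing.Theory Num.Theory.
Import numFieldNormedType.Exports.
Local Open Scope classical_set_scope.
Local Open Scope ring_scope.

(* Coordinates identify N with Z^2 (columns), M = Hom(N, Z) with integer rows
   (acting by left multiplication), and N_Q with Q^2. *)
Notation latN := 'cV[int]_2.
Notation latM := 'rV[int]_2.
Notation NQ := 'cV[rat]_2.

Definition toNQ (u : latN) : NQ := map_mx intr u.

Definition pairing (w : latM) (u : latN) : int := (w *m u) 0 0.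

Definition pairingQ (w : latM) (x : NQ) : rat := (map_mx intr w *m x) 0 0.

Definition primitiveN (u : latN) : bool := coprimez (u 0 0) (u 1 0).

Definition primitiveM (w : latM) : bool := coprimez (w 0 0) (w 0 1).

Definition conv_hull (A : set NQ) : set NQ := smallest (@convex_set rat NQ) A.

(* The empty polytope is allowed (A = set0). *)
Definition lattice_polytope (P : set NQ) : Prop :=
  exists2 A : set latN, finite_set A & P = conv_hull (toNQ @` A).

Definition vertices (P : set NQ) : set NQ :=
  [set v | P v /\ forall (x y : NQ) (t : rat), P x -> P y -> 0 < t < 1 ->
    v = t *: x + (1 - t) *: y -> x = v /\ y = v].

(* rat only carries a topology as the regular module rat^o; this is the usual
   Euclidean topology of Q^2. *)
Definition strict_interior (P : set NQ) : set NQ :=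
  interior (P : set 'cV[rat^o]_2).

Definition boundary (P : set NQ) : set NQ :=
  closure (P : set 'cV[rat^o]_2) `\` strict_interior P.

(* Full-dimensionality of P follows from the condition on the origin. *)
Definition fano (P : set NQ) : Prop :=
  [/\ lattice_polytope P,
      strict_interior P 0 &
      vertices P `<=` toNQ @` [set u | primitiveN u]].

Definition AutP (P : set NQ) : set 'M[int]_2 :=
  [set G | G \in unitmx /\ (fun x : NQ => map_mx intr G *m x) @` P = P].

Definition symmetric_polygon (P : set NQ) : Prop :=
  [set x : NQ | forall G, AutP P G -> map_mx intr G *m x = x] = [set 0].

Definition minkowski (A B : set NQ) : set NQ := [set x + y | x in A & y in B].

Definition dilate (k : int) (A : set NQ) : set NQ := [set k%:~R *: x | x in A].

Definition latticeAt (w : latM) (h : int) : set NQ :=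
  toNQ @` [set u | pairing w u = h].

Definition sliceAt (w : latM) (P : set NQ) (h : int) : set NQ :=
  conv_hull (P `&` latticeAt w h).

Definition verticesAt (w : latM) (P : set NQ) (h : int) : set NQ :=
  vertices P `&` latticeAt w h.

(* h_min and h_max are integers because P is a lattice polygon. *)
Definition is_hmin (w : latM) (P : set NQ) (h : int) : Prop :=
  (exists2 x, P x & pairingQ w x = h%:~R) /\
  (forall x, P x -> h%:~R <= pairingQ w x).

Definition is_hmax (w : latM) (P : set NQ) (h : int) : Prop :=
  (exists2 x, P x & pairingQ w x = h%:~R) /\
  (forall x, P x -> pairingQ w x <= h%:~R).

(* F is a factor of P with respect to w, as witnessed by the family R_h. *)
Definition factor_with (w : latM) (P F : set NQ) (hmin : int)
    (R : int -> set NQ) : Prop :=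
  [/\ lattice_polytope F,
      pairingQ w @` F = [set 0] &
      forall h : int, hmin <= h < 0 ->
        [/\ lattice_polytope (R h),
            verticesAt w P h `<=` minkowski (R h) (dilate `|h| F) &
            minkowski (R h) (dilate `|h| F) `<=` sliceAt w P h]].

Definition mut_with (w : latM) (P F : set NQ) (hmin hmax : int)
    (R : int -> set NQ) : set NQ :=
  conv_hull
    ((\bigcup_(h in [set h : int | hmin <= h < 0]) R h) `|`
     (\bigcup_(h in [set h : int | 0 <= h <= hmax])
        minkowski (sliceAt w P h) (dilate h F))).

(* Q = mut_w(P, F) for some primitive w and some factor F. The result does not
   depend on R, so quantifying over all admissible R yields the same Q. *)
Definition is_mutation (P Q : set NQ) : Prop :=
  exists (w : latM) (F : set NQ) (hmin hmax : int) (R : int -> set NQ),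
    [/\ primitiveM w, is_hmin w P hmin, is_hmax w P hmax,
        factor_with w P F hmin R & Q = mut_with w P F hmin hmax R].

Definition boundary_points (P : set NQ) : set latN :=
  [set u | boundary P (toNQ u)].

(* card_le compares the (finite) numbers of boundary lattice points. *)
Definition minimal (P : set NQ) : Prop :=
  forall Q : set NQ, is_mutation P Q ->
    (boundary_points P #<= boundary_points Q)%card.

(* Main.v *)
Require Import Defs.
From mathcomp Require Import all_boot all_order all_algebra.
From mathcomp Require Import all_classical.
From mathcomp Require Import topology normedtype convex interval_inference.
From mathcomp Require Import ring lra zify.

(** A mutation trades boundary points of the bottom edge for boundary points of
the top edge. Complete [w] to coordinates [(xi, w)] of the lattice and let
[a <= b] be the extreme values of [xi] on the factor [F]. If the row of [P] at
height [h] runs from [L h] to [R h], then the row of the mutation [Q] runs from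
[L h + h a] to [R h + h b]: both sides of [P] undergo lattice shears, and the two
shears differ by [h (b - a)] ([mut_lower], [mut_attained]). Hence the lattice
points on the two sides are preserved, the bottom edge loses
[- hmin * (b - a)] points and the top edge gains [hmax * (b - a)]. So [Q] has at
least as many boundary points as [P] as soon as [a = b] or [- hmin <= hmax];
[boundary_le] proves this with an explicit injection.

Symmetry enters only to show that [a < b] forces [- hmin <= hmax]
([symmetric_height]). A factor of positive length [l] makes the bottom edge of [P],
at height [- k], at least [k l] long. A group of integer matrices whose only
fixed point is 0 contains a rotation [G <> 1] of determinant 1
([symmetric_rotation]). Suppose that [P] stays below height [k]. Since [G] and
its inverse add up to the trace [t] of [G], applying both to a point of the
bottom edge gives [- 2 < t <= 2]. If [t] is 0 or 1 then [- 1] is a power of [G],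
and [P] reaches height [k]. If [t = 2] then [G] fixes both ends of the bottom
edge, so [G = 1]. If [t = - 1] then [G] maps the bottom edge strictly between the
heights 0 and [k], while the heights of the images of two points at distance
[k l] differ by a multiple of [k]; so the image is horizontal again, which a
matrix of order 3 does not allow.

Since everything lives over the rationals, compactness is not available.
Instead, polytopes are shown to be hulls of their vertices by discarding
generators that are not extreme ([hull_vertices]), to be closed by separating a
point from finitely many generators ([separation]), and their interiors are
described by feasible directions ([interior_feasible], [feasible_interior]). *)

Set Implicit Arguments.
Unset Strict Implicit.
Unset Printing Implicit Defensive.
Import Order.TTheory GRing.Theory Num.Theory.
Import numFieldNormedType.Exports.
Local Open Scope classical_set_scope.
Local Open Scope ring_scope.

(** * Convex hulls and vertices in the rational plane *)

(** Convexity with an explicit rational weight, which [lra] and [nra] can use;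
[convex_setP] relates it to [convex_set]. *)
Definition cvx (A : set NQ) :=
  forall (x y : NQ) (t : rat), A x -> A y -> 0 <= t <= 1 ->
    A (t *: x + (1 - t) *: y).

Lemma convex_setP (A : set NQ) : @convex_set rat NQ A <-> cvx A.
Proof.
split=> cA x y t.
  move=> Ax Ay /andP[t0 t1].
  have t01 : Itv.spec (@Itv.num_sem rat) (Itv.Real `[0%Z, 1%Z]) t.
    by rewrite /= /Itv.num_sem/= in_itv/= ger0_real // t0 t1.
  have := cA x y (Itv.mk t01); rewrite !inE => /(_ Ax Ay).
  by [].
rewrite !inE => Ax Ay; apply: cA => //.
by rewrite ge0 le1.
Qed.

Lemma sub_hull (A : set NQ) : A `<=` conv_hull A.
Proof. exact: sub_gen_smallest. Qed.

Lemma hull_sub (A C : set NQ) : cvx C -> A `<=` C -> conv_hull A `<=` C.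
Proof. by move=> /convex_setP cC AC; apply: smallest_sub. Qed.

Lemma cvx_hull (A : set NQ) : cvx (conv_hull A).
Proof.
move=> x y t Ax Ay t01 C [cC AC]; apply: (iffLR (convex_setP C)) => //.
  exact: Ax.
exact: Ay.
Qed.

Lemma hullS (A B : set NQ) : A `<=` B -> conv_hull A `<=` conv_hull B.
Proof. by move=> AB; apply: hull_sub (@cvx_hull B) _ => x /AB /sub_hull. Qed.

Lemma NQ_eq (x y : NQ) : x 0 0 = y 0 0 -> x 1 0 = y 1 0 -> x = y.
Proof.
move=> e0 e1; apply/matrixP => i j; rewrite (ord1 j).
case: i => -[|[|//]] li.
- by rewrite (_ : Ordinal li = 0) //; apply: val_inj.
- by rewrite (_ : Ordinal li = 1) //; apply: val_inj.
Qed.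

Lemma pairingQE (w : latM) x :
  pairingQ w x = (w 0 0)%:~R * x 0 0 + (w 0 1)%:~R * x 1 0.
Proof.
rewrite /pairingQ mxE !big_ord_recl big_ord0 addr0 !mxE.
by rewrite (_ : lift 0 0 = 1) //; apply: val_inj.
Qed.

Lemma pairingE (w : latM) x :
  pairing w x = w 0 0 * x 0 0 + w 0 1 * x 1 0.
Proof.
rewrite /pairing mxE !big_ord_recl big_ord0 addr0.
by rewrite (_ : lift 0 0 = 1) //; apply: val_inj.
Qed.

Lemma pairing_toNQ (w : latM) u : pairingQ w (toNQ u) = (pairing w u)%:~R.
Proof. by rewrite pairingQE pairingE !mxE intrD !intrM. Qed.

Lemma pairingQD w x y : pairingQ w (x + y) = pairingQ w x + pairingQ w y.
Proof. by rewrite !pairingQE !mxE; ring. Qed.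
Lemma pairingQZ w t x : pairingQ w (t *: x) = t * pairingQ w x.
Proof. by rewrite !pairingQE !mxE; ring. Qed.
Lemma pairingQN w x : pairingQ w (- x) = - pairingQ w x.
Proof. by rewrite !pairingQE !mxE; ring. Qed.
Lemma pairingQ0 w : pairingQ w 0 = 0.
Proof. by rewrite !pairingQE !mxE; ring. Qed.
Lemma pairingNQ w x : pairingQ (- w) x = - pairingQ w x.
Proof. by rewrite !pairingQE !mxE !intrN; ring. Qed.

Definition pairQE := (pairingQD, pairingQZ, pairingQN, pairingQ0, pairingNQ).

Lemma div01 (a b : rat) : 0 <= a <= b -> b != 0 -> 0 <= a / b <= 1.
Proof.
move=> /andP[a0 ab] b0; have bp : 0 < b by rewrite lt_def b0 (le_trans a0).
by rewrite divr_ge0 ?(ltW bp) // ler_pdivrMr ?mul1r.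
Qed.

(** The points of the segments from [b] to the hull of [C] already form a convex
set. The disjunction is needed when [C] is empty. *)
Lemma hull_cons (b : NQ) (C : set NQ) x :
  conv_hull (b |` C) x ->
  x = b \/ exists t c, [/\ conv_hull C c, 0 <= t <= 1 & x = t *: b + (1 - t) *: c].
Proof.
pose J y := y = b \/
  exists t c, [/\ conv_hull C c, 0 <= t <= 1 & y = t *: b + (1 - t) *: c].
suff cJ : cvx J.
  apply: (hull_sub cJ) => y [->|Cy]; first by left.
  right; exists 0, y; rewrite lexx ler01 scale0r add0r subr0 scale1r.
  by split => //; apply: sub_hull.
(* Based at b, a convex combination of b + r (c - b) and b + s (d - b) only has
   to combine the displacements. *)
have JE y : J y <-> exists2 r, (0 <= r <= 1) & y = b \/ 
    exists2 c, conv_hull C c & y = b + r *: (c - b).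
  split=> [[->|[t [c [hc t01 ->]]]]|[r r01 [->|[c hc ->]]]].
  - by exists 0; [rewrite lexx ler01 | left].
  - exists (1 - t); first by lra.
    by right; exists c => //; apply: NQ_eq; rewrite !mxE; ring.
  - by left.
  - right; exists (1 - r), c; split => //; first by lra.
    by apply: NQ_eq; rewrite !mxE; ring.
move=> y z t /JE[r r01 Jy] /JE[s s01 Jz] t01.
case: Jy => [->|[c hc ->]]; case: Jz => [->|[d hd ->]].
- by left; apply: NQ_eq; rewrite !mxE; ring.
- apply/JE; exists ((1 - t) * s); first by nra.
  by right; exists d => //; apply: NQ_eq; rewrite !mxE; ring.
- apply/JE; exists (t * r); first by nra.
  by right; exists c => //; apply: NQ_eq; rewrite !mxE; ring.
- have [q0|q0] := eqVneq (t * r + (1 - t) * s) 0.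
    have [tr ts] : t * r = 0 /\ (1 - t) * s = 0 by split; nra.
    left; rewrite !scalerDr !scalerA tr ts !scale0r !addr0 -scalerDl.
    by rewrite addrC subrK scale1r.
  apply/JE; exists (t * r + (1 - t) * s); first by nra.
  right; exists ((t * r) / (t * r + (1 - t) * s) *: c
             + (1 - (t * r) / (t * r + (1 - t) * s)) *: d).
    by apply: cvx_hull => //; apply: div01 => //; nra.
  by apply: NQ_eq; rewrite !mxE; field.
Qed.

(** If [b] were a proper convex combination of two points of the join of [b] and
[C], solving for [b] would express it by points of the hull of [C] alone. *)
Lemma vertex_cons (P : set NQ) (b : NQ) (C : set NQ) :
  P = conv_hull (b |` C) -> ~ conv_hull C b -> vertices P b.
Proof.
move=> PE nCb; split; first by rewrite PE; apply: sub_hull; left.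
move=> x y t; rewrite PE => hx hy t01 bE.
have key (r s : rat) c d : conv_hull C c -> conv_hull C d -> 0 <= r <= 1 ->
  0 <= s <= 1 -> b = t *: (b + r *: (c - b)) + (1 - t) *: (b + s *: (d - b)) ->
  r = 0 /\ s = 0.
  move=> hc hd r01 s01 e.
  have [q0|q0] := eqVneq (t * r + (1 - t) * s) 0; first by split; nra.
  case: nCb.
  have -> : b = (t * r) / (t * r + (1 - t) * s) *: c
             + (1 - (t * r) / (t * r + (1 - t) * s)) *: d.
    apply: (scalerI q0); apply/eqP; rewrite -subr_eq0; apply/eqP.
    have : t *: (b + r *: (c - b)) + (1 - t) *: (b + s *: (d - b)) - b = 0.
      by apply/eqP; rewrite subr_eq0; apply/eqP.
    move=> e'; rewrite -oppr0 -e'.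
    by apply: NQ_eq; rewrite !mxE; field.
  by apply: cvx_hull => //; apply: div01 => //; nra.
have dec z : conv_hull (b |` C) z -> z = b \/
    exists r c, [/\ conv_hull C c, 0 <= r <= 1 & z = b + r *: (c - b)].
  move=> /hull_cons[->|[r [c [hc r01 ->]]]]; first by left.
  right; exists (1 - r), c; split => //; first by lra.
  by apply: NQ_eq; rewrite !mxE; ring.
have bb c (r : rat) : r = 0 -> b + r *: (c - b) = b.
  by move=> ->; rewrite scale0r addr0.
case: (dec _ hx) => [xb|[r [c [hc r01 xE]]]];
  case: (dec _ hy) => [yb|[s [d [hd s01 yE]]]] //.
- have [] := key 0 s d d hd hd; rewrite ?lexx ?ler01 //.
    by rewrite scale0r addr0 -yE {1}bE xb.
  by move=> _ /bb s0; rewrite yE s0 xb.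
- have [] := key r 0 c c hc hc; rewrite ?lexx ?ler01 //.
    by rewrite scale0r addr0 -xE {1}bE yb.
  by move=> /bb r0 _; rewrite xE r0 yb.
- have [] := key r s c d hc hd r01 s01; first by rewrite -xE -yE.
  by move=> /bb r0 /bb s0; rewrite xE yE r0 s0.
Qed.

(** By [vertex_cons], a generator that is not a vertex lies in the hull of the
others and can be dropped; the induction is on the number of generators. *)
Lemma hull_vertices (s : seq NQ) :
  conv_hull [set` s] `<=` conv_hull (vertices (conv_hull [set` s])).
Proof.
have [n] := ubnP (size s); elim: n s => // n IH s sn.
have [allV|] := pselect (forall b, b \in s -> vertices (conv_hull [set` s]) b).
  by apply: hullS => b; apply: allV.
move=> /existsNP[b /not_implyP[bs nv]].
have sE : [set` s] = b |` [set` rem b s].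
  apply/seteqP; split=> x /=.
    by rewrite (perm_mem (perm_to_rem bs)) inE => /predU1P[->|]; [left|right].
  by case=> [->//|/mem_rem].
have hb : conv_hull [set` rem b s] b.
  by apply: contrapT => nb; apply: nv; apply: vertex_cons nb; rewrite sE.
have hE : conv_hull [set` s] = conv_hull [set` rem b s].
  apply/seteqP; split; last by apply: hullS => x /mem_rem.
  apply: hull_sub; first exact: cvx_hull.
  by rewrite sE => x [->//|]; apply: sub_hull.
by rewrite hE; apply: IH; rewrite size_rem //; case: (s) sn bs.
Qed.

(** * Separation, closedness and interiors *)

Lemma small_factor (T : eqType) (s : seq T) (x y : T -> rat) :
  (forall a, a \in s -> 0 < x a) ->
  exists2 c, 0 < c & forall a, a \in s -> 0 < x a + c * y a.
Proof.
elim: s => [_|b s IH xs]; first by exists 1.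
have [|c c0 H] := IH; first by move=> a sa; apply: xs; rewrite inE sa orbT.
have xb : 0 < x b by apply: xs; rewrite inE eqxx.
have [d d0 Hd] : exists2 d, 0 < d & 0 < x b + d * y b.
  have z0 : 0 < 1 + `|y b| by have := normr_ge0 (y b); lra.
  exists (x b / (1 + `|y b|)); first by rewrite divr_gt0.
  have yb : - (1 + `|y b|) < y b by rewrite ltrNl;
    have := ler_norm (- y b); rewrite normrN; lra.
  have -> : x b + x b / (1 + `|y b|) * y b
      = x b * ((1 + `|y b| + y b) / (1 + `|y b|)) by field; lra.
  by rewrite mulr_gt0 // divr_gt0 //; lra.
exists (Num.min c d); first by rewrite lt_min c0.
have scale (u v e f : rat) : 0 < u -> 0 < u + e * v -> 0 < f -> f <= e -> 0 < u + f * v.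
  by move=> *; nra.
have mn : 0 < Num.min c d by rewrite lt_min c0.
move=> a; rewrite inE => /predU1P[->|sa].
  by apply: scale Hd mn _ => //; rewrite ge_min lexx orbT.
apply: scale (H a sa) mn _; last by rewrite ge_min lexx.
by apply: xs; rewrite inE sa orbT.
Qed.

Lemma hull_combination3 (A : set NQ) (p x y z : NQ) (a b c : rat) :
  conv_hull A x -> conv_hull A y -> conv_hull A z ->
  0 <= a -> 0 <= b -> 0 <= c -> 0 < a + b + c ->
  a *: (x - p) + b *: (y - p) + c *: (z - p) = 0 -> conv_hull A p.
Proof.
move=> hx hy hz a0 b0 c0 s0 e.
have pE : (a + b + c) *: p = a *: x + b *: y + c *: z.
  apply/eqP; rewrite eq_sym -subr_eq0 -e; apply/eqP.
  by apply: NQ_eq; rewrite !mxE; ring.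
have sn : a + b + c != 0 by rewrite gt_eqF.
have [ab|ab] := eqVneq (a + b) 0.
  have [a1 b1] : a = 0 /\ b = 0 by split; lra.
  suff -> : p = z by [].
  by apply: (scalerI sn); rewrite pE a1 b1 !scale0r !add0r.
pose y' := (a / (a + b)) *: x + (1 - a / (a + b)) *: y.
have hy' : conv_hull A y' by apply: cvx_hull => //; apply: div01; rewrite //; lra.
have -> : p = ((a + b) / (a + b + c)) *: y' + (1 - (a + b) / (a + b + c)) *: z.
  apply: (scalerI sn); rewrite pE.
  by apply: NQ_eq; rewrite !mxE; field; rewrite sn ab.
by apply: cvx_hull => //; apply: div01; rewrite //; lra.
Qed.

Definition lf (l : rat * rat) (x : NQ) := l.1 * x 0 0 + l.2 * x 1 0.

(** Gordan's alternative in the plane, by induction on the generators. Let [l]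
separate [p] from [s] but not from the new generator [v], and let [D] be the
determinant against [v - p]. Then [D] has constant sign on [s], for otherwise [p]
would be a combination of [v] and at most two points of [s]. So [D] up to sign,
tilted slightly towards [v - p], is the functional wanted. *)
Lemma separation (s : seq NQ) (p : NQ) : ~ conv_hull [set` s] p ->
  exists l, forall a, a \in s -> lf l p < lf l a.
Proof.
elim: s => [_|v s IH nh]; first by exists (0, 0).
have [|l lP] := IH.
  by move=> h; apply: nh; apply: hullS h => a sa /=; rewrite inE sa orbT.
have hv : conv_hull [set` v :: s] v by apply: sub_hull; rewrite /= inE eqxx.
have hs a : a \in s -> conv_hull [set` v :: s] a.
  by move=> sa; apply: sub_hull; rewrite /= inE sa orbT.
have [lv|lv] := ltP (lf l p) (lf l v).
  by exists l => a; rewrite inE => /predU1P[->|/lP].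
pose D (a : NQ) := (v - p) 0 0 * (a - p) 1 0 - (v - p) 1 0 * (a - p) 0 0.
pose E (a : NQ) := (v - p) 0 0 * (a - p) 0 0 + (v - p) 1 0 * (a - p) 1 0.
have Ev : 0 < E v.
  have vp : v != p by apply/eqP => vp; apply: nh; rewrite -vp.
  rewrite lt_def /E addr_ge0 ?sqr_ge0 // andbT; apply: contraNneq vp.
  move=> e; have [e0 e1] : (v - p) 0 0 = 0 /\ (v - p) 1 0 = 0 by split; nra.
  apply/eqP; apply: NQ_eq; move: e0 e1; rewrite !mxE; lra.
have D0 a : a \in s -> D a != 0.
  move=> sa; apply/eqP => Da; apply: nh.
  apply: (@hull_combination3 _ p a v v (lf l p - lf l v) (lf l a - lf l p) 0);
    rewrite ?subr_ge0 //; try exact: hs.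
  - by apply/ltW/lP.
  - by have := lP _ sa; lra.
  - apply: NQ_eq.
      transitivity (l.2 * D a); last by rewrite Da mulr0 mxE.
      by rewrite /D /lf !mxE; ring.
    transitivity (- l.1 * D a); last by rewrite Da mulr0 mxE.
    by rewrite /D /lf !mxE; ring.
have Dsame a b : a \in s -> b \in s -> 0 < D a -> D b < 0 -> False.
  move=> sa sb Da Db; apply: nh.
  have la := lP _ sa; have lb := lP _ sb.
  apply: (@hull_combination3 _ p a b v (D b * (lf l v - lf l p))
     (D a * (lf l p - lf l v)) (D a * (lf l b - lf l p) - D b * (lf l a - lf l p)));
    try exact: hs; try by [].
  - by nra.
  - by nra.
  - by nra.
  - by nra.
  - by rewrite /D /lf; apply: NQ_eq; rewrite !mxE; ring.
have [sg sgP] : exists sg : rat, forall a, a \in s -> 0 < sg * D a.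
  have [[b [sb Db]]|H] := pselect (exists b, b \in s /\ D b < 0).
    exists (-1) => a sa; have := Dsame a b sa sb.
    have := D0 _ sa; rewrite neq_lt => /orP[Da _|Da /(_ Da Db)] //; lra.
  exists 1 => a sa; rewrite mul1r lt_def (D0 _ sa) /= leNgt.
  by apply/negP => Da; apply: H; exists a.
have [c c0 cP] := @small_factor _ s (fun a => sg * D a) E sgP.
exists (sg * - (v - p) 1 0 + c * (v - p) 0 0, sg * (v - p) 0 0 + c * (v - p) 1 0).
move=> a as_; rewrite -subr_gt0.
have -> : lf (sg * - (v - p) 1 0 + c * (v - p) 0 0,
   sg * (v - p) 0 0 + c * (v - p) 1 0) a - lf (sg * - (v - p) 1 0 + c * (v - p) 0 0,
   sg * (v - p) 0 0 + c * (v - p) 1 0) p = sg * D a + c * E a.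
  by rewrite /lf /D /E !mxE /=; ring.
move: as_; rewrite inE => /predU1P[->|/cP //].
have -> : D v = 0 by rewrite /D; ring.
by rewrite mulr0 add0r mulr_gt0.
Qed.

Lemma ball_cV (p : 'cV[rat^o]_2) (e : rat) (y : 'cV[rat^o]_2) : 0 < e ->
  ball p e y <-> `|p 0 0 - y 0 0| < e /\ `|p 1 0 - y 1 0| < e.
Proof.
move=> e0; split=> [[_ b]|[b0 b1]].
  by split; [have := b 0 0 | have := b 1 0].
split=> // i j; rewrite (ord1 j).
case: i => -[|[|//]] li.
- by rewrite (_ : Ordinal li = 0) //; apply: val_inj.
- by rewrite (_ : Ordinal li = 1) //; apply: val_inj.
Qed.

(** A separating functional has a gap [m > 0] on the finitely many generators,
so a whole ball around [p] avoids the hull. *)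
Lemma closure_hull (s : seq NQ) (p : NQ) :
  closure (conv_hull [set` s] : set 'cV[rat^o]_2) p -> conv_hull [set` s] p.
Proof.
move=> clp; apply: contrapT => /separation[l lP].
have [m m0 mP] := @small_factor _ s (fun a => lf l a - lf l p) (fun=> -1)
  (fun a sa => ltac:(by rewrite subr_gt0 lP)).
have sub : conv_hull [set` s] `<=` [set x | lf l p + m <= lf l x].
  apply: hull_sub => [x y t /= hx hy t01|x /= /mP]; last lra.
  have -> : lf l (t *: x + (1 - t) *: y) = t * lf l x + (1 - t) * lf l y.
    by rewrite /lf !mxE; ring.
  by nra.
have d0 : 0 < 1 + `|l.1| + `|l.2|.
  by have := normr_ge0 l.1; have := normr_ge0 l.2; lra.
have [] := clp (ball (p : 'cV[rat^o]_2) (m / (1 + `|l.1| + `|l.2|))).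
  by apply: nbhsx_ballx; rewrite divr_gt0.
move=> x [/sub /= lx /ball_cV []]; first by rewrite divr_gt0.
set e := m / _ => b0 b1.
have e0 : 0 < e by rewrite divr_gt0.
have : lf l x - lf l p <= `|l.1| * e + `|l.2| * e.
  have -> : lf l x - lf l p = l.1 * (x 0 0 - p 0 0) + l.2 * (x 1 0 - p 1 0).
    by rewrite /lf; ring.
  apply: lerD; apply: (le_trans (ler_norm _)); rewrite normrM;
    apply: ler_wpM2l => //; by rewrite distrC ltW.
have : e * (1 + `|l.1| + `|l.2|) = m by rewrite /e divfK // gt_eqF.
by lra.
Qed.

(** At a point of a convex set the feasible directions form a convex cone, and
the point is interior exactly when this cone is the whole plane. This replaces
ball computations by linear algebra. *)
Definition feasible (P : set NQ) (p d : NQ) := exists2 e, 0 < e & P (p + e *: d).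

Lemma feasible_shrink (P : set NQ) p d (e f : rat) : cvx P -> P p ->
  P (p + e *: d) -> 0 <= f <= e -> P (p + f *: d).
Proof.
move=> cP Pp Pe f0e.
have [e0|e0] := eqVneq e 0; first by have -> : f = e by lra.
have -> : p + f *: d = (f / e) *: (p + e *: d) + (1 - f / e) *: p.
  by apply: NQ_eq; rewrite !mxE; field.
by apply: cP => //; apply: div01.
Qed.

Lemma feasibleD (P : set NQ) p c d : cvx P -> P p ->
  feasible P p c -> feasible P p d -> feasible P p (c + d).
Proof.
move=> cP Pp [e e0 Pe] [f f0 Pf]; set m := Num.min e f.
have m0 : 0 < m by rewrite lt_min e0.
have Pc : P (p + m *: c).
  by apply: feasible_shrink Pe _; rewrite // ltW //= ge_min lexx.
have Pd : P (p + m *: d).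
  by apply: feasible_shrink Pf _; rewrite // ltW //= ge_min lexx orbT.
exists (m / 2); first by rewrite divr_gt0.
have -> : p + (m / 2) *: (c + d) =
  (1 / 2) *: (p + m *: c) + (1 - 1 / 2) *: (p + m *: d).
  by apply: NQ_eq; rewrite !mxE; field.
by apply: cP => //; lra.
Qed.

Lemma feasibleZ (P : set NQ) p d (c : rat) : P p -> 0 <= c ->
  feasible P p d -> feasible P p (c *: d).
Proof.
move=> Pp; rewrite le_eqVlt => /predU1P[<-|c0] [e e0 Pe].
  by exists 1 => //; rewrite scale0r scaler0 addr0.
exists (e / c); first by rewrite divr_gt0.
by rewrite scalerA divfK // gt_eqF.
Qed.

Lemma interior_feasible (P : set NQ) p d : strict_interior P p -> feasible P p d.
Proof.
rewrite /strict_interior /interior /= => /nbhs_ballP[e /= e0 eP].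
have z0 : 0 < 1 + `|d 0 0| + `|d 1 0|.
  by have := normr_ge0 (d 0 0); have := normr_ge0 (d 1 0); lra.
exists (e / (1 + `|d 0 0| + `|d 1 0|)); first by rewrite divr_gt0.
set f := e / _; have f0 : 0 < f by rewrite divr_gt0.
have fe : f * (1 + `|d 0 0| + `|d 1 0|) = e by rewrite /f divfK // gt_eqF.
have := normr_ge0 (d 0 0); have := normr_ge0 (d 1 0) => n1 n0.
by apply/eP/ball_cV => //; split;
  rewrite !mxE opprD addrA subrr add0r normrN normrM (gtr0_norm f0); nra.
Qed.

(** Steps of length [e] along both axes are enough: every nearby point is the
midpoint of a point on each of the two axes through [p]. *)
Lemma feasible_interior (P : set NQ) p : cvx P -> P p ->
  (forall d, feasible P p d) -> strict_interior P p.
Proof.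
move=> cP Pp fP.
have mk d : exists2 e, 0 < e & forall f, `|f| <= e -> P (p + f *: d).
  have [e e0 Pe] := fP d; have [e' e'0 Pe'] := fP (- d).
  exists (Num.min e e'); first by rewrite lt_min e0.
  move=> f; rewrite le_min => /andP[fe fe'].
  have [f0|f0] := leP 0 f.
    by apply: feasible_shrink Pe _; rewrite // f0 -(ger0_norm f0).
  have -> : p + f *: d = p + (- f) *: - d by rewrite scalerN scaleNr opprK.
  by apply: feasible_shrink Pe' _; rewrite // -(ltr0_norm f0) fe' normr_ge0.
have [e e0 Pe] := mk (delta_mx 0 0); have [f f0 Pf] := mk (delta_mx 1 0).
rewrite /strict_interior /interior /=; apply/nbhs_ballP.
exists (Num.min e f / 2); first by rewrite /= divr_gt0 // lt_min e0.
have m0 : 0 < Num.min e f / 2 by rewrite divr_gt0 // lt_min e0.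
move=> y /(ball_cV _ _ m0) [b0 b1].
have -> : y = (1 / 2) *: (p + (2 * (y 0 0 - p 0 0)) *: delta_mx 0 0)
    + (1 - 1 / 2) *: (p + (2 * (y 1 0 - p 1 0)) *: delta_mx 1 0).
  by apply: NQ_eq; rewrite !mxE /=; field.
have me : Num.min e f <= e by rewrite ge_min lexx.
have mf : Num.min e f <= f by rewrite ge_min lexx orbT.
apply: cP; last by lra.
  by apply: Pe; rewrite normrM distrC ger0_norm //; lra.
by apply: Pf; rewrite normrM distrC ger0_norm //; lra.
Qed.

(** * Lattice polytopes in unimodular coordinates *)

Lemma finite_hull (P : set NQ) : lattice_polytope P ->
  exists s : seq latN, P = conv_hull [set` map toNQ s].
Proof.
case=> A /finite_seqP[s ->] ->; exists s; congr conv_hull.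
apply/seteqP; split=> x /=.
  by case=> u us <-; apply: map_f.
by case/mapP => u us ->; exists u.
Qed.

Lemma polytope_cvx P : lattice_polytope P -> cvx P.
Proof. by case=> A _ ->; apply: cvx_hull. Qed.

Lemma polytope_vertices P : lattice_polytope P -> P `<=` conv_hull (vertices P).
Proof. by case/finite_hull => s ->; apply: hull_vertices. Qed.

Lemma polytope_closed P (p : NQ) : lattice_polytope P ->
  closure (P : set 'cV[rat^o]_2) p -> P p.
Proof. by case/finite_hull => s ->; apply: closure_hull. Qed.

Lemma pairing_max (xi : latM) (s : seq latN) : s != [::] ->
  exists2 u, u \in s & forall v, v \in s -> pairing xi v <= pairing xi u.
Proof.
elim: s => // u s IH _; have [->|/IH[v vs vP]] := eqVneq s [::].
  by exists u; rewrite ?inE // => v; rewrite inE => /eqP ->.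
have [uv|uv] := leP (pairing xi u) (pairing xi v).
  by exists v; [rewrite inE vs orbT | move=> x; rewrite inE => /predU1P[->|/vP]].
exists u; first by rewrite inE eqxx.
by move=> x; rewrite inE => /predU1P[->//|/vP xv]; apply: le_trans xv (ltW uv).
Qed.

Definition row_max (xi w : latM) (P : set NQ) (p : NQ) :=
  forall q, P q -> pairingQ w q = pairingQ w p -> pairingQ xi q <= pairingQ xi p.

(** The bottom edge of a lattice polytope has a lattice point as its [xi]-maximal
end. Negating [xi] gives the other end, and negating [w] the top edge. *)
Lemma edge_max (xi w : latM) P (h : int) : lattice_polytope P -> is_hmin w P h ->
  exists u, [/\ P (toNQ u), pairing w u = h & row_max xi w P (toNQ u)].
Proof.
case/finite_hull => s -> [[x Px wx] hP].
pose t := [seq u <- s | pairing w u == h].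
have sP u : u \in s -> conv_hull [set` map toNQ s] (toNQ u).
  by move=> us; apply: sub_hull; rewrite /= map_f.
have ht : forall u, u \in s -> u \notin t -> h%:~R < pairingQ w (toNQ u).
  move=> u us; rewrite mem_filter negb_and us orbF => wu.
  have := hP _ (sP _ us); rewrite le_eqVlt => /predU1P[/eqP|//].
  by rewrite pairing_toNQ eqr_int eq_sym (negbTE wu).
have tn : t != [::].
  apply/eqP => t0; suff : h%:~R < pairingQ w x by rewrite wx ltxx.
  apply: (@hull_sub [set` map toNQ s] [set y | h%:~R < pairingQ w y]) Px.
    move=> y z r /= hy hz r01; rewrite !pairQE.
    have [->|r0] := eqVneq r 0; first by lra.
    by nra.
  by move=> y /= /mapP[u us ->]; apply: ht; rewrite ?t0.
have [u] := pairing_max xi tn; rewrite mem_filter => /andP[/eqP wu us] uM.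
exists u; split; [exact: sP | exact: wu|].
move=> q Pq; rewrite !pairing_toNQ wu => wq.
(* The conditional inequality cuts out a convex set because a combination lies on
   the bottom edge only if its ends do. *)
pose C := [set y | h%:~R <= pairingQ w y /\
  (pairingQ w y = h%:~R -> pairingQ xi y <= (pairing xi u)%:~R)].
suff /(_ q Pq)[_ /(_ wq)] : conv_hull [set` map toNQ s] `<=` C by [].
apply: hull_sub.
  move=> y z r [y1 y2] [z1 z2] r01; split; rewrite !pairQE; first by nra.
  have [->|r0] := eqVneq r 0.
    by rewrite !mul0r !add0r subr0 !mul1r.
  have [->|r1] := eqVneq r 1.
    by rewrite subrr !mul0r !addr0 !mul1r.
  move=> e.
  have yh : pairingQ w y = h%:~R by nra.
  have zh : pairingQ w z = h%:~R by nra.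
  by have := y2 yh; have := z2 zh; nra.
move=> y /= /mapP[v vs ->]; split; first by apply: hP; apply: sP.
rewrite !pairing_toNQ => /eqP; rewrite eqr_int ler_int => vh.
by apply: uM; rewrite mem_filter vh.
Qed.

Definition unimodular (xi w : latM) := xi 0 0 * w 0 1 - xi 0 1 * w 0 0 = 1.

Lemma primitive_unimodular (w : latM) : primitiveM w -> exists xi, unimodular xi w.
Proof.
move=> /coprimezP[[u v] /= uv].
exists (\row_i if i == 0 then v else - u); rewrite /unimodular !mxE /=.
by rewrite -uv; ring.
Qed.

(** Inverse of the coordinate map [(xi, w)], by Cramer's rule. *)
Definition latpt (xi w : latM) (x h : int) : latN :=
  \col_i if i == 0 then x * w 0 1 - h * xi 0 1 else h * xi 0 0 - x * w 0 0.

Section Coordinates.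
Variables xi w : latM.
Hypothesis uni : unimodular xi w.

Lemma xi_latpt x h : pairing xi (latpt xi w x h) = x.
Proof.
transitivity (x * (xi 0 0 * w 0 1 - xi 0 1 * w 0 0)); last by rewrite uni mulr1.
by rewrite pairingE !mxE /=; ring.
Qed.

Lemma w_latpt x h : pairing w (latpt xi w x h) = h.
Proof.
transitivity (h * (xi 0 0 * w 0 1 - xi 0 1 * w 0 0)); last by rewrite uni mulr1.
by rewrite pairingE !mxE /=; ring.
Qed.

Lemma coord_inj (p q : NQ) : pairingQ xi p = pairingQ xi q ->
  pairingQ w p = pairingQ w q -> p = q.
Proof.
move=> e1 e2.
have uniQ : (xi 0 0)%:~R * (w 0 1)%:~R - (xi 0 1)%:~R * (w 0 0)%:~R = 1 :> rat.
  by rewrite -!intrM -intrB uni.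
have inv (x : NQ) : x 0 0 = pairingQ xi x * (w 0 1)%:~R - pairingQ w x * (xi 0 1)%:~R
  /\ x 1 0 = pairingQ w x * (xi 0 0)%:~R - pairingQ xi x * (w 0 0)%:~R.
  split.
    transitivity (x 0 0 * ((xi 0 0)%:~R * (w 0 1)%:~R - (xi 0 1)%:~R * (w 0 0)%:~R)).
      by rewrite uniQ mulr1.
    by rewrite !pairingQE; ring.
  transitivity (x 1 0 * ((xi 0 0)%:~R * (w 0 1)%:~R - (xi 0 1)%:~R * (w 0 0)%:~R)).
    by rewrite uniQ mulr1.
  by rewrite !pairingQE; ring.
have [p0 p1] := inv p; have [q0 q1] := inv q.
by apply: NQ_eq; rewrite ?p0 ?q0 ?p1 ?q1 e1 e2.
Qed.

Lemma lat_coord_inj (u v : latN) : pairing xi u = pairing xi v ->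
  pairing w u = pairing w v -> u = v.
Proof.
move=> e1 e2; have := @coord_inj (toNQ u) (toNQ v).
rewrite !pairing_toNQ e1 e2 => /(_ erefl erefl) e.
apply/matrixP => i j; have := congr1 (fun x : NQ => x i j) e.
by rewrite !mxE => /eqP; rewrite eqr_int => /eqP.
Qed.

Lemma cvx_between (Q : set NQ) p q q' : cvx Q -> Q q -> Q q' ->
  pairingQ w q = pairingQ w p -> pairingQ w q' = pairingQ w p ->
  pairingQ xi q <= pairingQ xi p <= pairingQ xi q' -> Q p.
Proof.
move=> cQ Qq Qq' wq wq' /andP[l1 l2].
have [e|ne] := eqVneq (pairingQ xi q') (pairingQ xi q).
  by suff -> : p = q by []; apply: coord_inj => //; lra.
pose t := (pairingQ xi p - pairingQ xi q) / (pairingQ xi q' - pairingQ xi q).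
have -> : p = t *: q' + (1 - t) *: q.
  apply: coord_inj; rewrite !pairQE ?wq ?wq'; last by ring.
  by rewrite /t; field; rewrite subr_eq0.
by apply: cQ => //; apply: div01; rewrite ?subr_eq0 //; lra.
Qed.

(** Horizontal directions are feasible by the points [q1] and [q2] of the same row;
any other direction is a multiple of [z1 - p] or [z2 - p] plus a horizontal one. *)
Lemma feasible_all (P : set NQ) p z1 z2 q1 q2 : cvx P -> P p ->
  P z1 -> P z2 -> pairingQ w z1 < pairingQ w p < pairingQ w z2 ->
  P q1 -> P q2 -> pairingQ w q1 = pairingQ w p -> pairingQ w q2 = pairingQ w p ->
  pairingQ xi q1 < pairingQ xi p < pairingQ xi q2 ->
  forall d, feasible P p d.
Proof.
move=> cP Pp Pz1 Pz2 /andP[wz1 wz2] Pq1 Pq2 wq1 wq2 /andP[xq1 xq2].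
have to q : P q -> feasible P p (q - p).
  by move=> Pq; exists 1; rewrite // scale1r addrC subrK.
have hor d : pairingQ w d = 0 -> feasible P p d.
  move=> wd; have [d0|d0] := leP 0 (pairingQ xi d).
    have -> : d = (pairingQ xi d / (pairingQ xi q2 - pairingQ xi p)) *: (q2 - p).
      apply: coord_inj; rewrite !pairQE ?wq2 ?wd; last by ring.
      by field; lra.
    by apply: feasibleZ; rewrite ?divr_ge0 ?subr_ge0 ?(ltW xq2) //; apply: to.
  have -> : d = (- pairingQ xi d / (pairingQ xi p - pairingQ xi q1)) *: (q1 - p).
    apply: coord_inj; rewrite !pairQE ?wq1 ?wd; last by ring.
    by field; lra.
  by apply: feasibleZ; rewrite ?divr_ge0 ?subr_ge0 ?oppr_ge0 ?(ltW xq1) ?(ltW d0) //;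
    apply: to.
move=> d.
have [z [Pz [zp ws]]] : exists z, P z /\ (pairingQ w z - pairingQ w p != 0 /\
    0 <= pairingQ w d / (pairingQ w z - pairingQ w p)).
  have [d0|d0] := leP 0 (pairingQ w d).
    by exists z2; split=> //; split; [lra | rewrite divr_ge0 //; lra].
  exists z1; split=> //; split; first by lra.
  by rewrite -mulrNN -invrN mulr_ge0 ?invr_ge0; lra.
set al := _ / _ in ws.
have -> : d = al *: (z - p) + (d - al *: (z - p)) by rewrite addrC subrK.
apply: feasibleD => //; first by apply: feasibleZ => //; apply: to.
by apply: hor; rewrite !pairQE /al; field.
Qed.

Lemma boundary_row (P : set NQ) (p z1 z2 : NQ) : cvx P -> P p ->
  P z1 -> P z2 -> pairingQ w z1 < pairingQ w p < pairingQ w z2 ->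
  ~ strict_interior P p -> row_max xi w P p \/ row_max (- xi) w P p.
Proof.
move=> cP Pp Pz1 Pz2 wz np; apply: contrapT => /not_orP[].
move=> /existsNP[q2 /not_implyP[Pq2 /not_implyP[wq2 /negP]]]; rewrite -ltNge => xq2.
move=> /existsNP[q1 /not_implyP[Pq1 /not_implyP[wq1 /negP]]].
rewrite -ltNge !pairQE ltrN2 => xq1.
apply/np/feasible_interior => //.
by apply: (feasible_all cP Pp Pz1 Pz2 wz Pq1 Pq2) => //; rewrite xq1.
Qed.

End Coordinates.

Lemma boundaryI (Q : set NQ) (q : NQ) : Q q -> ~ strict_interior Q q -> boundary Q q.
Proof. by move=> Qq nq; split=> //; apply: subset_closure. Qed.

Lemma support_boundary (l : latM) (Q : set NQ) (q d : NQ) : Q q ->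
  (forall q', Q q' -> pairingQ l q' <= pairingQ l q) -> 0 < pairingQ l d ->
  boundary Q q.
Proof.
move=> Qq qM ld; apply: boundaryI => // /(@interior_feasible _ _ d)[e e0 /qM].
by rewrite !pairQE gerDl leNgt mulr_gt0.
Qed.

Lemma row_boundary (w xi : latM) (Q : set NQ) (q d : NQ) : Q q ->
  row_max xi w Q q -> pairingQ w d = 0 -> 0 < pairingQ xi d -> boundary Q q.
Proof.
move=> Qq qM wd ld; apply: boundaryI => // /(@interior_feasible _ _ d)[e e0 /qM].
by rewrite !pairQE wd mulr0 addr0 gerDl leNgt mulr_gt0 // => /(_ erefl).
Qed.


(** * The rows of a mutation *)

Section Mutation.
Variables (w : latM) (P F : set NQ) (hmin hmax : int) (R : int -> set NQ).
Hypotheses (latP : lattice_polytope P) (factF : factor_with w P F hmin R).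

Lemma factor_height f : F f -> pairingQ w f = 0.
Proof.
case: factF => _ F0 _ Ff.
have : (pairingQ w @` F) (pairingQ w f) by exists f.
by rewrite F0.
Qed.

Lemma slice_sub h x : sliceAt w P h x -> P x /\ pairingQ w x = h%:~R.
Proof.
suff : sliceAt w P h `<=` [set y | P y /\ pairingQ w y = h%:~R] by move=> sub /sub.
apply: hull_sub => [y z t [Py wy] [Pz wz] t01|y [Py [u /= wu uy]]]; rewrite -?uy in Py *.
  split; first exact: polytope_cvx latP _ _ _ Py Pz t01.
  by rewrite !pairQE wy wz; ring.
by split; [exact: Py|rewrite pairing_toNQ wu].
Qed.

Lemma remainder_shift h r f : hmin <= h < 0 -> R h r -> F f ->
  [/\ P (r - h%:~R *: f), pairingQ w (r - h%:~R *: f) = h%:~R & pairingQ w r = h%:~R].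
Proof.
move=> hh Rr Ff; case: factF => _ _ /(_ h hh)[_ _ sub].
have [Px wx] : P (r - h%:~R *: f) /\ pairingQ w (r - h%:~R *: f) = h%:~R.
  apply: slice_sub; apply: sub; exists r => //; exists (`|h|%:~R *: f); first by exists f.
  by rewrite ltr0_norm 1?intrN ?scaleNr //; case/andP: hh.
by split=> //; move: wx; rewrite !pairQE (factor_height Ff) mulr0 subr0.
Qed.

Local Notation Q := (mut_with w P F hmin hmax R).

(** Together with [mut_attained], this says that the left side of the mutation is
the left side of [P] sheared by [h * pairingQ xi f0], at positive and negative
heights alike. Both statements compare rows through sets that are convex because
the shear is linear in the height, so they only have to be checked on generators.
Applied to [- xi], they describe the right side. *)
Lemma mut_lower (xi : latM) f0 : F f0 ->
  (forall f, F f -> pairingQ xi f0 <= pairingQ xi f) ->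
  forall q, Q q -> exists p, [/\ P p, pairingQ w p = pairingQ w q &
    pairingQ xi p + pairingQ w q * pairingQ xi f0 <= pairingQ xi q].
Proof.
move=> Ff0 f0P q.
pose C := [set q | exists p, [/\ P p, pairingQ w p = pairingQ w q &
    pairingQ xi p + pairingQ w q * pairingQ xi f0 <= pairingQ xi q]].
suff sub : Q `<=` C by exact: sub.
apply: hull_sub.
  move=> x y t [p [Pp wp lp]] [p' [Pp' wp' lp']] t01.
  exists (t *: p + (1 - t) *: p'); split.
  - exact: polytope_cvx latP _ _ _ Pp Pp' t01.
  - by rewrite !pairQE wp wp'.
  - by rewrite !pairQE; nra.
move=> x [] [h /= hh].
  move=> Rx; have [Px wx wr] := remainder_shift hh Rx Ff0.
  exists (x - h%:~R *: f0); split; rewrite ?wr // !pairQE.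
  lra.
move=> [s Ss] [_ [f Ff <-] <-]; have [Ps ws] := slice_sub Ss.
exists s; rewrite !pairQE (factor_height Ff) mulr0 addr0; split=> //.
rewrite ws lerD2l ler_wpM2l ?f0P // ler0z.
by case/andP: hh.
Qed.

Lemma mut_top (h : int) u f : 0 <= h <= hmax -> P (toNQ u) -> pairing w u = h ->
  F f -> Q (toNQ u + h%:~R *: f).
Proof.
move=> hh Pu wu Ff; apply: sub_hull; right; exists h => //=.
exists (toNQ u); first by apply: sub_hull; split => //; exists u.
by exists (h%:~R *: f) => //; exists f.
Qed.

Hypothesis vertP : vertices P `<=` toNQ @` [set u | primitiveN u].
Hypotheses (hminP : forall p, P p -> hmin%:~R <= pairingQ w p)
           (hmaxP : forall p, P p -> pairingQ w p <= hmax%:~R).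

(** A row of [P] at negative height may contain no vertex, and then nothing is
required of [R h]; the bound for such rows comes from the vertices of other rows
by convexity. *)
Lemma mut_attained (xi : latM) f0 : F f0 ->
  (forall f, F f -> pairingQ xi f0 <= pairingQ xi f) ->
  forall p, P p -> exists q, [/\ Q q, pairingQ w q = pairingQ w p &
    pairingQ xi q <= pairingQ xi p + pairingQ w p * pairingQ xi f0].
Proof.
move=> Ff0 f0P p Pp.
pose C := [set p | exists q, [/\ Q q, pairingQ w q = pairingQ w p &
    pairingQ xi q <= pairingQ xi p + pairingQ w p * pairingQ xi f0]].
suff /(_ p (polytope_vertices latP Pp)) : conv_hull (vertices P) `<=` C by [].
apply: hull_sub.
  move=> x y t [q [Qq wq lq]] [q' [Qq' wq' lq']] t01.
  exists (t *: q + (1 - t) *: q'); split.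
  - exact: cvx_hull Qq Qq' t01.
  - by rewrite !pairQE wq wq'.
  - by rewrite !pairQE; nra.
move=> v Vv; have [u _ uv] := vertP Vv; have Pv := Vv.1.
set h := pairing w u.
have wv : pairingQ w v = h%:~R by rewrite -uv pairing_toNQ.
have hh : hmin <= h <= hmax.
  by rewrite -(ler_int rat) -(ler_int rat h) -wv hminP ?hmaxP.
have [h0|h0] := leP 0 h.
  exists (v + h%:~R *: f0); split.
  - by rewrite -uv; apply: mut_top => //; [rewrite h0; case/andP: hh | rewrite uv].
  - by rewrite !pairQE (factor_height Ff0) mulr0 addr0.
  - by rewrite !pairQE wv.
have hh' : hmin <= h < 0 by rewrite h0 andbT; case/andP: hh.
case: factF => _ _ /(_ h hh')[_ + _].
have Vh : verticesAt w P h v by split=> //; exists u.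
move=> /(_ v Vh)[r Rr [_ [f Ff <-]]] vE; exists r.
have [_ _ wr] := remainder_shift hh' Rr Ff; split; rewrite ?wr ?wv //.
  by apply: sub_hull; left; exists h.
rewrite -vE !pairQE ltr0_norm // intrN.
have : h%:~R * (pairingQ xi f - pairingQ xi f0) <= 0.
  by rewrite mulr_le0_ge0 ?subr_ge0 ?f0P // lerz0 ltW.
lra.
Qed.

(** The end of a row of [P] is carried to the end of the corresponding row of [Q]
by the shear; [d] points out of [Q]. *)
Lemma mut_row_end (xi : latM) f0 (p q d : NQ) : F f0 ->
  (forall f, F f -> pairingQ xi f0 <= pairingQ xi f) ->
  P p -> row_max (- xi) w P p ->
  (forall q', pairingQ xi q' = pairingQ xi q -> pairingQ w q' = pairingQ w q ->
     q' = q) ->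
  pairingQ w q = pairingQ w p ->
  pairingQ xi q = pairingQ xi p + pairingQ w p * pairingQ xi f0 ->
  pairingQ w d = 0 -> pairingQ xi d < 0 -> boundary Q q.
Proof.
move=> Ff0 f0P Pp pM inj wq xq wd xd.
have lo q' : Q q' -> pairingQ w q' = pairingQ w p -> pairingQ xi q <= pairingQ xi q'.
  move=> /(mut_lower Ff0 f0P)[p' [Pp' wp' lp']] wq'; rewrite wq' in wp' lp'.
  by have := pM _ Pp' wp'; rewrite !pairQE; lra.
have [q' [Qq' wq' lq']] := mut_attained Ff0 f0P Pp.
have Qq : Q q.
  rewrite -(inj q') ?wq ?wq' //; apply/eqP; rewrite eq_le lo // andbT.
  by rewrite xq.
apply: (@row_boundary w (- xi) _ _ d) => //; last by rewrite !pairQE oppr_gt0.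
by move=> q'' /lo; rewrite wq => /[apply]; rewrite !pairQE lerN2.
Qed.

End Mutation.

(** * Symmetric polygons are not taller below than above *)

Local Notation act G x := (map_mx intr G *m x : NQ).

Lemma ord2 (i : 'I_2) : i = 0 \/ i = 1.
Proof. by case: i => -[|[|//]] li; [left|right]; apply: val_inj. Qed.

Lemma mulmx2E (A : pzSemiRingType) m n (B : 'M[A]_(m, 2)) (C : 'M_(2, n)) i j :
  (B *m C) i j = B i 0 * C 0 j + B i 1 * C 1 j.
Proof.
rewrite !mxE !big_ord_recl big_ord0 addr0.
by rewrite (_ : lift 0 0 = 1) //; apply: val_inj.
Qed.

Lemma det2E (A : comPzRingType) (B : 'M[A]_2) :
  \det B = B 0 0 * B 1 1 - B 0 1 * B 1 0.
Proof.
rewrite (expand_det_row _ 0) !big_ord_recl big_ord0 addr0 /cofactor !det_mx11 !mxE.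
rewrite (_ : lift 0 0 = 1); last exact: val_inj.
rewrite (_ : lift 1 0 = 0); last exact: val_inj.
by rewrite /= expr0 expr1 mul1r mulN1r mulrN.
Qed.

Lemma actE (G : 'M[int]_2) (x : NQ) i :
  act G x i 0 = (G i 0)%:~R * x 0 0 + (G i 1)%:~R * x 1 0.
Proof. by rewrite mulmx2E !mxE. Qed.

Lemma actM (G H : 'M[int]_2) (x : NQ) : act (G *m H) x = act G (act H x).
Proof. by rewrite map_mxM mulmxA. Qed.

(** Cayley-Hamilton for a matrix of determinant 1. *)
Lemma act_cayley (G : 'M[int]_2) (x : NQ) : \det G = 1 ->
  act G (act G x) = (G 0 0 + G 1 1)%:~R *: act G x - x.
Proof.
rewrite det2E => dG.
have dQ : (G 0 0)%:~R * (G 1 1)%:~R - (G 0 1)%:~R * (G 1 0)%:~R = 1 :> rat.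
  by rewrite -!intrM -intrB dG.
have key i : act G (act G x) i 0 = ((G 0 0 + G 1 1)%:~R *: act G x) i 0
   - ((G 0 0)%:~R * (G 1 1)%:~R - (G 0 1)%:~R * (G 1 0)%:~R) * x i 0.
  have ZE (c : rat) (y : NQ) : (c *: y) i 0 = c * y i 0 by rewrite mxE.
  rewrite actE ZE !actE intrD; case: (ord2 i) => ->; ring.
apply: NQ_eq; rewrite key dQ mul1r [RHS]mxE; congr (_ + _); by rewrite [RHS]mxE.
Qed.

Lemma AutP_mul P (G H : 'M[int]_2) : AutP P G -> AutP P H -> AutP P (G *m H).
Proof.
move=> [uG GP] [uH HP]; split; first by rewrite unitmx_mul uG.
rewrite -{2}GP -{2}HP image_comp; apply: eq_imagel => x _ /=; exact: actM.
Qed.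

Lemma AutP_act P G x : AutP P G -> P x -> P (act G x).
Proof. by case=> _ GP Px; rewrite -GP; exists x. Qed.

(** The image is that of [x] under the inverse of [G], which is the trace minus
[G]. *)
Lemma AutP_act_inv P G x : AutP P G -> \det G = 1 -> P x ->
  P ((G 0 0 + G 1 1)%:~R *: x - act G x).
Proof.
move=> [_ GP] dG; rewrite -{1}GP => -[y Py <-].
by rewrite -/(act G (act G y)) act_cayley // opprD addrA subrr add0r opprK.
Qed.

(** If only the identity had determinant 1, the group would be trivial or consist
of 1 and one involution [S], and the points [x + S x] would be fixed. They cannot
all vanish, because [- 1] has determinant 1. *)
Lemma symmetric_rotation P : symmetric_polygon P ->
  exists G, [/\ AutP P G, \det G = 1 & G <> 1%:M].
Proof.
move=> sP; apply: contrapT => noG.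
have rot1 G : AutP P G -> \det G = 1 -> G = 1%:M.
  by move=> aG dG; apply: contrapT => G1; apply: noG; exists G.
have fix0 (x : NQ) : (forall G, AutP P G -> act G x = x) -> x = 0.
  by move=> xP; have : [set 0] x by rewrite -sP.
have e0 : delta_mx 0 0 != 0 :> NQ.
  by apply/eqP => /matrixP /(_ 0 0) /eqP; rewrite !mxE /= oner_eq0.
have [[S [aS dS]]|noS] := pselect (exists S, AutP P S /\ \det S = -1); last first.
  move/eqP: e0; apply; apply: fix0 => G aG.
  have : \det G \is a GRing.unit by rewrite -unitmxE; case: aG.
  rewrite qualifE /= => /orP[/eqP dG|/eqP dG]; last by case: noS; exists G.
  by rewrite (rot1 G) // map_mx1 mul1mx.
have SS : S *m S = 1%:M.
  by apply: rot1; [exact: AutP_mul | rewrite det_mulmx dS].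
have fixS (x : NQ) : x + act S x = 0.
  apply: fix0 => G aG.
  have : \det G \is a GRing.unit by rewrite -unitmxE; case: aG.
  rewrite qualifE /= => /orP[/eqP dG|/eqP dG].
    by rewrite (rot1 G) // map_mx1 mul1mx.
  have -> : G = S.
    rewrite -[G]mulmx1 -SS mulmxA (rot1 (G *m S)) ?mul1mx //; first exact: AutP_mul.
    by rewrite det_mulmx dG dS.
  by rewrite mulmxDr -actM SS map_mx1 mul1mx addrC.
have := congr1 (fun x : NQ => x 0 0) (fixS (delta_mx 0 0)).
have := congr1 (fun x : NQ => x 1 0) (fixS (delta_mx 0 0)).
have := congr1 (fun x : NQ => x 0 0) (fixS (delta_mx 1 0)).
have := congr1 (fun x : NQ => x 1 0) (fixS (delta_mx 1 0)).
have mE (x y : NQ) i : (x + y) i 0 = x i 0 + y i 0 by rewrite mxE.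
rewrite !mE !actE !mxE /= !mulr0 !mulr1 !add0r !addr0 => s11 s01 s10 s00.
move: dS; rewrite det2E => /(congr1 (intr : int -> rat)).
by rewrite intrB !intrM s01 mul0r subr0 => dS; move: s11 s00 dS; nra.
Qed.

(** The points [v1] and [v2] witness that the bottom edge contains [- hmin] times a
nonzero lattice vector [g], which is what a factor of positive length requires. *)
Lemma symmetric_height (P : set NQ) (xi w : latM) (hmin hmax : int)
    (v1 v2 : NQ) (g : latN) :
  unimodular xi w -> lattice_polytope P -> symmetric_polygon P ->
  is_hmin w P hmin -> is_hmax w P hmax -> hmin < 0 -> P v1 -> P v2 ->
  pairingQ w v1 = hmin%:~R -> v2 - v1 = (- hmin)%:~R *: toNQ g ->
  pairing w g = 0 -> pairing xi g != 0 -> - hmin <= hmax.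
Proof.
move=> uni latP sP minP maxP hmin0 Pv1 Pv2 wv1 v21 wg xg.
rewrite leNgt; apply/negP => hlt.
have [G [aG dG G1]] := symmetric_rotation sP.
set t := G 0 0 + G 1 1.
pose k : rat := (- hmin)%:~R.
have k0 : 0 < k by rewrite /k ltr0z oppr_gt0.
have Plo x : P x -> - k <= pairingQ w x.
  by move=> Px; rewrite /k intrN opprK; apply: minP.2.
have Phi x : P x -> pairingQ w x < k.
  by move=> Px; apply: le_lt_trans (maxP.2 x Px) _; rewrite ltr_int.
have wv1k : pairingQ w v1 = - k by rewrite wv1 /k intrN opprK.
have PG x : P x -> P (act G x) by exact: AutP_act.
have PGi x : P x -> P (t%:~R *: x - act G x) by exact: AutP_act_inv.
have GG x : act G (act G x) = t%:~R *: act G x - x by exact: act_cayley.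
have GD x y : act G (x + y) = act G x + act G y by rewrite mulmxDr.
have GZ c x : act G (c *: x) = c *: act G x by rewrite -scalemxAr.
have GB x y : act G (x - y) = act G x - act G y by rewrite mulmxBr.
have noN : P (- v1) -> False.
  by move=> /Phi; rewrite pairingQN wv1k opprK ltxx.
have [tlo thi] : - 2 < t /\ t <= 2.
  have := Plo _ (PG _ Pv1); have := Plo _ (PGi _ Pv1).
  have := Phi _ (PG _ Pv1); have := Phi _ (PGi _ Pv1).
  rewrite !pairQE wv1k => a1 a2 a3 a4.
  by rewrite -(ltr_int rat) -(ler_int rat); split; nra.
have v2E : v2 = v1 + k *: toNQ g by rewrite -v21 addrC subrK.
have wgQ : pairingQ w (toNQ g) = 0 by rewrite pairing_toNQ wg.
have xgQ : pairingQ xi (toNQ g) != 0 by rewrite pairing_toNQ intr_eq0.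
have tcase : [\/ t = -1, t = 0, t = 1 | t = 2].
  have : t = -1 \/ t = 0 \/ t = 1 \/ t = 2 by lia.
  by move=> [|[|[|]]] e; [constructor 1|constructor 2|constructor 3|constructor 4].
case: tcase => te.
  (* Order 3: the three images of a point have heights adding up to 0. *)
- have rng v : P v -> pairingQ w v = - k -> 0 < pairingQ w (act G v) < k.
    move=> Pv wv; rewrite Phi ?andbT; last exact: PG.
    by have := Phi _ (PGi _ Pv); rewrite te !pairQE wv; lra.
  have /andP[a1 a2] := rng _ Pv1 wv1k.
  have wv2 : pairingQ w v2 = - k by rewrite v2E !pairQE wgQ wv1k; ring.
  have /andP[b1 b2] := rng _ Pv2 wv2.
  have mG : act G (toNQ g) = toNQ (G *m g) by rewrite /toNQ map_mxM.
  have m0 : pairing w (G *m g) = 0.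
    move: b1 b2; rewrite v2E GD GZ mG !pairQE pairing_toNQ => b1 b2.
    have : -1 < pairing w (G *m g) by rewrite -(ltr_int rat); nra.
    have : pairing w (G *m g) < 1 by rewrite -(ltr_int rat); nra.
    by lia.
  (* As w vanishes on g and on its image, it is an eigenvector of G with rational
     eigenvalue c, but c ^ 2 + c + 1 has no root. *)
  pose c := pairingQ w (act G v1) / - k.
  pose b := (pairingQ xi (act G v1) - c * pairingQ xi v1) / pairingQ xi (toNQ g).
  have Gv : act G v1 = c *: v1 + b *: toNQ g.
    apply: (coord_inj uni); rewrite !pairQE.
      by rewrite /b; field.
    by rewrite wgQ wv1k /c; field; rewrite intr_eq0 lt_eqF.
  have wGv : pairingQ w (act G v1) = - c * k.
    by rewrite Gv !pairQE wgQ wv1k; ring.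
  have : pairingQ w (act G (act G v1)) = - c * c * k.
    by rewrite Gv GD !GZ mG !pairQE pairing_toNQ m0 wGv; ring.
  rewrite GG te !pairQE wGv wv1k => e.
  have : k * (c * c + c + 1) = 0 by move: e; lra.
  by move/eqP; rewrite mulf_eq0 gt_eqF //= => /eqP; nra.
  (* Order 4: the square of G is -1. *)
- apply: noN; have := PG _ (PG _ Pv1).
  by rewrite GG te scale0r add0r.
  (* Order 6: the cube of G is -1. *)
- apply: noN; have := PG _ (PG _ (PG _ Pv1)).
  by rewrite !GG te !scale1r addrAC subrr add0r.
(* Trace 2: G x and 2 x - G x both lie on the bottom edge if x does, so an end x of
   that edge is fixed. *)
have [u [Pu wu umax]] := edge_max xi latP minP.
have [u' [Pu' wu' umin]] := edge_max (- xi) latP minP.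
have hk : hmin%:~R = - k by rewrite /k intrN opprK.
have fixed (xi' : latM) z : (xi' = xi \/ xi' = - xi) -> P z ->
    pairingQ w z = - k -> row_max xi' w P z -> act G z = z.
  move=> xiE Pz wz zmax.
  have lo1 := Plo _ (PG _ Pz); have lo2 := Plo _ (PGi _ Pz).
  have wG : pairingQ w (act G z) = - k.
    by move: lo2; rewrite te !pairQE wz; lra.
  have x1 := zmax _ (PG _ Pz); have x2 := zmax _ (PGi _ Pz).
  move: x1 x2; rewrite te wz wG => /(_ erefl).
  rewrite !pairQE wz wG => x1 x2.
  have {}x2 := x2 ltac:(ring).
  apply: (coord_inj uni); last by rewrite wG wz.
  by case: xiE x1 x2 => ->; rewrite ?pairQE; lra.
have wuQ : pairingQ w (toNQ u) = - k by rewrite pairing_toNQ wu.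
have wuQ' : pairingQ w (toNQ u') = - k by rewrite pairing_toNQ wu'.
have Gu : act G (toNQ u) = toNQ u by apply: (fixed xi) => //; left.
have Gu' : act G (toNQ u') = toNQ u' by apply: (fixed (- xi)) => //; right.
have xne : pairingQ xi (toNQ u) - pairingQ xi (toNQ u') != 0.
  have wv2 : pairingQ w v2 = - k by rewrite v2E !pairQE wgQ wv1k; ring.
  have := umax v1 Pv1; have := umax v2 Pv2; have := umin v1 Pv1; have := umin v2 Pv2.
  rewrite wv1k wv2 wuQ wuQ' => /(_ erefl) a1 /(_ erefl) a2 /(_ erefl) a3 /(_ erefl) a4.
  have : pairingQ xi v1 != pairingQ xi v2.
    rewrite v2E !pairQE -subr_eq0 opprD addrA subrr add0r oppr_eq0.
    by rewrite mulf_neq0 // gt_eqF.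
  move: a1 a2 a3 a4; rewrite !pairQE => a1 a2 a3 a4; apply: contraNneq => e.
  by apply/eqP; lra.
apply: G1.
have Gid x : act G x = x.
  pose c := pairingQ w x / - k.
  pose b := (pairingQ xi x - c * pairingQ xi (toNQ u)) /
    (pairingQ xi (toNQ u) - pairingQ xi (toNQ u')).
  have -> : x = c *: toNQ u + b *: (toNQ u - toNQ u').
    apply: (coord_inj uni); rewrite !pairQE ?wuQ ?wuQ' /b.
      by field.
    by rewrite /c; field; rewrite xne intr_eq0 lt_eqF.
  by rewrite GD !GZ GB Gu Gu'.
apply/matrixP => i j.
have := congr1 (fun x : NQ => x i 0) (Gid (delta_mx j 0)).
rewrite actE !mxE => e; apply/eqP; rewrite -(eqr_int rat).
by move: e; case: (ord2 i) => ->; case: (ord2 j) => -> /=;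
  rewrite ?mulr0 ?mulr1 ?addr0 ?add0r => ->.
Qed.

(** * Comparing the boundaries *)

Section Count.
Variables (w xi : latM) (P F : set NQ) (hmin hmax : int) (R : int -> set NQ).
Variables (ua ub : latN).
Hypotheses (uni : unimodular xi w) (fanoP : fano P).
Hypotheses (factF : factor_with w P F hmin R).
Hypotheses (minP : is_hmin w P hmin) (maxP : is_hmax w P hmax).
Hypotheses (Fa : F (toNQ ua)) (Fb : F (toNQ ub)).
Hypotheses (aP : forall f, F f -> pairingQ xi (toNQ ua) <= pairingQ xi f).
Hypotheses (bP : forall f, F f -> pairingQ xi f <= pairingQ xi (toNQ ub)).

Let latP : lattice_polytope P. Proof. by case: fanoP. Qed.
Let int0 : strict_interior P 0. Proof. by case: fanoP. Qed.
Let vertP : vertices P `<=` toNQ @` [set u | primitiveN u].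
Proof. by case: fanoP. Qed.
Local Notation Q := (mut_with w P F hmin hmax R).
Local Notation a := (pairing xi ua).
Local Notation b := (pairing xi ub).
Let cQ : cvx Q. Proof. exact: cvx_hull. Qed.

Let ab : a <= b.
Proof. by rewrite -(ler_int rat) -!pairing_toNQ aP. Qed.

Let bP' f : F f -> pairingQ (- xi) (toNQ ub) <= pairingQ (- xi) f.
Proof. by move=> Ff; rewrite !pairQE lerN2 bP. Qed.

Let hmin0 : hmin < 0.
Proof.
have [e e0 /minP.2] := interior_feasible (toNQ (latpt xi w 0 (-1))) int0.
rewrite !pairQE pairing_toNQ w_latpt // add0r => le.
by rewrite -(ltr_int rat); lra.
Qed.

Let hmax0 : 0 < hmax.
Proof.
have [e e0 /maxP.2] := interior_feasible (toNQ (latpt xi w 0 1)) int0.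
rewrite !pairQE pairing_toNQ w_latpt // add0r => le.
by rewrite -(ltr_int rat); lra.
Qed.

Let attained p : P p ->
  (exists q, [/\ Q q, pairingQ w q = pairingQ w p &
     pairingQ xi q <= pairingQ xi p + pairingQ w p * a%:~R]) /\
  (exists q, [/\ Q q, pairingQ w q = pairingQ w p &
     pairingQ xi p + pairingQ w p * b%:~R <= pairingQ xi q]).
Proof.
move=> Pp; split.
  have := mut_attained latP factF vertP minP.2 maxP.2 Fa aP Pp.
  by rewrite pairing_toNQ.
have [q [Qq wq lq]] := mut_attained latP factF vertP minP.2 maxP.2 Fb bP' Pp.
by exists q; split => //; move: lq; rewrite !pairQE pairing_toNQ; lra.
Qed.

Let lower q : Q q ->
  (exists p, [/\ P p, pairingQ w p = pairingQ w q &
     pairingQ xi p + pairingQ w q * a%:~R <= pairingQ xi q]) /\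
  (exists p, [/\ P p, pairingQ w p = pairingQ w q &
     pairingQ xi q <= pairingQ xi p + pairingQ w q * b%:~R]).
Proof.
move=> Qq; split.
  by have := mut_lower latP factF Fa aP Qq; rewrite pairing_toNQ.
have [p [Pp wp lp]] := mut_lower latP factF Fb bP' Qq.
by exists p; split => //; move: lp; rewrite !pairQE pairing_toNQ; lra.
Qed.

(** The bottom row of [Q] is nonempty, so the bottom row of [P] is at least
[- hmin * (b - a)] long, and [symmetric_height] applies to [ub - ua]. *)
Lemma factor_width : symmetric_polygon P -> a = b \/ - hmin <= hmax.
Proof.
move=> sP; have [->|ne] := eqVneq a b; [by left | right].
have [x Px wx] := minP.1.
have [[q [Qq wq _]] _] := attained Px.
have [[p1 [Pp1 wp1 l1]] [p2 [Pp2 wp2 l2]]] := lower Qq.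
have wg : pairingQ w (toNQ (ub - ua)) = 0.
  by rewrite /toNQ map_mxB !pairQE !(factor_height factF) // subrr.
have xg : pairing xi (ub - ua) = b - a by rewrite !pairingE !mxE; ring.
pose v2 := p1 + (- hmin)%:~R *: toNQ (ub - ua).
have Pv2 : P v2.
  apply: (cvx_between uni (polytope_cvx latP) Pp1 Pp2).
  - by rewrite !pairQE wg; ring.
  - by rewrite !pairQE wg wp1 wp2; ring.
  rewrite !pairQE pairing_toNQ xg.
  move: l1 l2; rewrite wq wx intrB intrN => l1 l2.
  have ab' : a%:~R <= b%:~R :> rat by rewrite ler_int.
  have h0 : hmin%:~R < 0 :> rat by rewrite ltrz0.
  by apply/andP; split; nra.
apply: (symmetric_height uni latP sP minP maxP hmin0 Pp1 Pv2).
- by rewrite wp1 wq wx.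
- by rewrite /v2 addrC addKr.
- by apply/eqP; rewrite -(eqr_int rat) -pairing_toNQ wg.
- by rewrite xg subr_eq0 eq_sym.
Qed.

(** At a height [h < 0] above the bottom, the row of [Q] contains two distinct
convex combinations of a bottom point with points on either side of 0, so its
left and right ends differ. *)
Let row_strict p p' (h : rat) : P p -> P p' ->
  pairingQ w p = h -> pairingQ w p' = h ->
  row_max (- xi) w P p -> row_max xi w P p' -> hmin%:~R < h -> h < 0 ->
  pairingQ xi p + h * a%:~R < pairingQ xi p' + h * b%:~R.
Proof.
move=> Pp Pp' wp wp' pM p'M hh h0.
have [x Px wx] := minP.1.
have [[qb [Qqb wqb _]] _] := attained Px.
have [e e0 Pe] := interior_feasible (toNQ (latpt xi w 1 0)) int0.
have [e' e'0 Pe'] := interior_feasible (toNQ (latpt xi w (-1) 0)) int0.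
have [[q1 [Qq1 wq1 lq1]] _] := attained Pe'.
have [_ [q2 [Qq2 wq2 lq2]]] := attained Pe.
move: lq1 lq2 wq1 wq2; rewrite !pairQE !pairing_toNQ !xi_latpt // !w_latpt //.
rewrite !mulr0 !addr0 !mul0r !addr0 !add0r => lq1 lq2 wq1 wq2.
pose t := h / hmin%:~R; have hn : hmin%:~R != 0 :> rat by lra.
have th : t * hmin%:~R = h by rewrite /t divfK.
have t01 : 0 <= t <= 1 by apply/andP; split; nra.
have t1 : t < 1 by nra.
have [[p1 [Pp1 wp1 l1]] _] := lower (cQ Qqb Qq1 t01).
have [_ [p2 [Pp2 wp2 l2]]] := lower (cQ Qqb Qq2 t01).
move: wp1 wp2 l1 l2; rewrite !pairQE wqb wq1 wq2 wx !mulr0 !addr0 th.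
move=> wp1 wp2 l1 l2.
have := pM p1 Pp1; have := p'M p2 Pp2; rewrite wp wp' => /(_ wp2) m2 /(_ wp1).
rewrite !pairQE lerN2 => m1.
by nra.
Qed.

Variables (ur ut : latN).
Hypotheses (Pur : P (toNQ ur)) (wur : pairing w ur = hmin).
Hypotheses (urM : row_max xi w P (toNQ ur)).
Hypotheses (Put : P (toNQ ut)) (wut : pairing w ut = hmax).
Hypotheses (utM : row_max xi w P (toNQ ut)).

Let left u := `[< row_max (- xi) w P (toNQ u) >].

(** The sides of [P] move by their shears, and so does the top edge along its left
end. The points of the bottom edge that no longer fit on the shorter bottom edge
of [Q] are those to the right of [ur] shifted by [hmin * (b - a)]; they continue
the image of the top edge to the right, where [Q] has gained room. *)
Let transfer u :=
  let x := pairing xi u in let h := pairing w u in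
  if h == hmax then latpt xi w (x + hmax * a) hmax
  else if h == hmin then
    if x <= pairing xi ur + hmin * (b - a) then latpt xi w (x + hmin * a) hmin
    else latpt xi w
      (pairing xi ut + hmax * a + (x - pairing xi ur - hmin * (b - a))) hmax
  else if left u then latpt xi w (x + h * a) h else latpt xi w (x + h * b) h.

Let boundary_row_end u : boundary P (toNQ u) ->
  [/\ P (toNQ u), hmin <= pairing w u <= hmax &
   hmin < pairing w u < hmax -> left u \/ row_max xi w P (toNQ u)].
Proof.
case=> /(polytope_closed latP) Pu nu; split=> //.
  rewrite -(ler_int rat) -(ler_int rat (pairing w u)) -pairing_toNQ.
  by rewrite minP.2 ?maxP.2.
rewrite -(ltr_int rat) -(ltr_int rat (pairing w u)) -pairing_toNQ.
have [x1 Px1 <-] := minP.1; have [x2 Px2 <-] := maxP.1 => hu.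
have [] := boundary_row uni (polytope_cvx latP) Pu Px1 Px2 hu nu; first by right.
by left; apply/asboolP.
Qed.

Let extreme_height_boundary x h : Q (toNQ (latpt xi w x h)) ->
  h = hmin \/ h = hmax -> boundary Q (toNQ (latpt xi w x h)).
Proof.
move=> Qq [] hE.
  apply: (@support_boundary (- w) _ _ (toNQ (latpt xi w 0 (-1))) Qq).
    move=> q /lower[[p [Pp wp _]] _].
    rewrite !pairQE lerN2 -wp pairing_toNQ w_latpt // hE.
    exact: minP.2.
  by rewrite !pairQE pairing_toNQ w_latpt // intrN opprK.
apply: (@support_boundary w _ _ (toNQ (latpt xi w 0 1)) Qq).
  move=> q /lower[[p [Pp wp _]] _]; rewrite -wp pairing_toNQ w_latpt // hE.
  exact: maxP.2.
by rewrite pairing_toNQ w_latpt.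
Qed.

Let left_boundary u : P (toNQ u) -> left u -> boundary Q
  (toNQ (latpt xi w (pairing xi u + pairing w u * a) (pairing w u))).
Proof.
move=> Pu /asboolP uM.
apply: (mut_row_end latP factF vertP minP.2 maxP.2 (xi := xi)
  (d := toNQ (latpt xi w (-1) 0)) Fa aP Pu uM).
- by move=> q'; apply: coord_inj.
- by rewrite !pairing_toNQ w_latpt.
- by rewrite !pairing_toNQ xi_latpt // intrD intrM.
- by rewrite pairing_toNQ w_latpt.
- by rewrite pairing_toNQ xi_latpt.
Qed.

Let right_boundary u : P (toNQ u) -> row_max xi w P (toNQ u) -> boundary Q
  (toNQ (latpt xi w (pairing xi u + pairing w u * b) (pairing w u))).
Proof.
rewrite -{1}[xi]opprK => Pu uM.
apply: (mut_row_end latP factF vertP minP.2 maxP.2 (xi := - xi)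
  (d := toNQ (latpt xi w 1 0)) Fb bP' Pu uM).
- by move=> q'; rewrite !pairQE => /oppr_inj; apply: coord_inj.
- by rewrite !pairing_toNQ w_latpt.
- by rewrite !pairQE !pairing_toNQ xi_latpt // intrD intrM; ring.
- by rewrite pairing_toNQ w_latpt.
- by rewrite !pairQE pairing_toNQ xi_latpt.
Qed.

Hypothesis wide : a = b \/ - hmin <= hmax.

Let transfer_boundary u : boundary P (toNQ u) -> boundary Q (toNQ (transfer u)).
Proof.
have hmaxQ : 0 <= hmax <= hmax by rewrite lexx ltW.
move=> /boundary_row_end[Pu hu um]; rewrite /transfer /=.
have [hM|hM] := eqVneq (pairing w u) hmax.
  apply: extreme_height_boundary; last by right.
  suff <- : toNQ u + hmax%:~R *: toNQ ua
      = toNQ (latpt xi w (pairing xi u + hmax * a) hmax) by apply: mut_top.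
  apply: (coord_inj uni); rewrite !pairQE !pairing_toNQ ?xi_latpt ?w_latpt //.
    by rewrite intrD intrM.
  have := factor_height factF Fa; rewrite pairing_toNQ => ->.
  by rewrite mulr0 addr0 hM.
have [hm|hm] := eqVneq (pairing w u) hmin; last first.
  have [lu|nlu] := boolP (left u); first exact: left_boundary.
  apply: right_boundary => //; case: um => //; last by move=> lu; rewrite lu in nlu.
  by lia.
have [xl|xl] := leP (pairing xi u) (pairing xi ur + hmin * (b - a)).
  apply: extreme_height_boundary; last by left.
  have [[q [Qq wq lq]] _] := attained Pu.
  have [_ [q' [Qq' wq' lq']]] := attained Pur.
  apply: (cvx_between uni cQ Qq Qq').
  - by rewrite wq !pairing_toNQ w_latpt // hm.
  - by rewrite wq' !pairing_toNQ w_latpt // wur.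
  - apply/andP; split.
      apply: le_trans lq _; rewrite !pairing_toNQ xi_latpt // hm.
      by rewrite intrD intrM.
    apply: le_trans _ lq'; rewrite !pairing_toNQ xi_latpt // wur.
    by rewrite -intrM -intrD ler_int; lia.
apply: extreme_height_boundary; last by right.
have Qa : Q (toNQ ut + hmax%:~R *: toNQ ua) by apply: mut_top.
have Qb : Q (toNQ ut + hmax%:~R *: toNQ ub) by apply: mut_top.
have wa := factor_height factF Fa; have wb := factor_height factF Fb.
apply: (cvx_between uni cQ Qa Qb).
- by rewrite !pairQE wa !pairing_toNQ w_latpt // wut mulr0 addr0.
- by rewrite !pairQE wb !pairing_toNQ w_latpt // wut mulr0 addr0.
rewrite !pairQE !pairing_toNQ xi_latpt // -!intrM -!intrD !ler_int.
have : pairing xi u <= pairing xi ur.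
  have := urM Pu; rewrite !pairing_toNQ hm wur => /(_ erefl).
  by rewrite ler_int.
(* The overhang is at most - hmin * (b - a), and the top row of Q extends
   hmax * (b - a) beyond the image of the top row of P. *)
by case: wide; nia.
Qed.

Let side_images_differ u v : boundary P (toNQ u) -> boundary P (toNQ v) ->
  left u -> ~~ left v -> pairing w u = pairing w v -> hmin < pairing w u < hmax ->
  pairing xi u + pairing w u * a != pairing xi v + pairing w u * b.
Proof.
move=> /boundary_row_end[Pu _ _] /boundary_row_end[Pv _ vm] lu nlv huv hu.
have {vm} vR : row_max xi w P (toNQ v).
  by move: vm; rewrite -huv => /(_ hu)[] // lv; rewrite lv in nlv.
move: lu => /asboolP uL.
have uv : pairing xi u < pairing xi v.
  rewrite lt_neqAle; apply/andP; split.
    apply: contraNneq nlv => e; have -> : v = u by apply: (lat_coord_inj uni).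
    exact/asboolP.
  have := vR _ Pu; rewrite !pairing_toNQ huv => /(_ erefl).
  by rewrite ler_int.
apply/eqP => e; have [h0|h0] := leP 0 (pairing w u).
  by have := ler_wpM2l h0 ab; lia.
have [] := andP hu; rewrite -(ltr_int rat) => hl _.
have h0' : (pairing w u)%:~R < 0 :> rat by rewrite ltrz0.
have := row_strict Pu Pv (pairing_toNQ w u) _ uL vR hl h0'.
rewrite !pairing_toNQ -huv -!intrM -!intrD ltr_int => /(_ erefl).
by rewrite e ltxx.
Qed.

Let transfer_inj u v : boundary P (toNQ u) -> boundary P (toNQ v) ->
  transfer u = transfer v -> u = v.
Proof.
move=> bu bv euv.
have e1 := congr1 (pairing xi) euv; have e2 := congr1 (pairing w) euv.
have [Pu hu um] := boundary_row_end bu; have [Pv hv vm] := boundary_row_end bv.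
(* This separates the image of the top edge from the points moved up to it. *)
have top x : P (toNQ x) -> pairing w x = hmax -> pairing xi x <= pairing xi ut.
  move=> Px wx; have := utM Px; rewrite !pairing_toNQ wx wut => /(_ erefl).
  by rewrite ler_int.
have tu := top u Pu; have tv := top v Pv.
have muv := side_images_differ bu bv; have mvu := side_images_differ bv bu.
apply: (lat_coord_inj uni); move: e1 e2; rewrite /transfer /=;
(have [hM|hM] := eqVneq (pairing w u) hmax;
 [|have [hm|hm] := eqVneq (pairing w u) hmin;
  [have [xl|xl] := leP (pairing xi u) (pairing xi ur + hmin * (b - a))
  |have [lu|nlu] := boolP (left u)]]);
(have [hM'|hM'] := eqVneq (pairing w v) hmax;
 [|have [hm'|hm'] := eqVneq (pairing w v) hmin;
  [have [xl'|xl'] := leP (pairing xi v) (pairing xi ur + hmin * (b - a))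
  |have [lv|nlv] := boolP (left v)]]);
rewrite !xi_latpt // !w_latpt // => e1 e2; try lia.
all: by rewrite e2 in e1; lia.
Qed.

Lemma transfer_card : (boundary_points P #<= boundary_points Q)%card.
Proof.
have injT : {in boundary_points P &, injective transfer}.
  by move=> u v; rewrite !inE; apply: transfer_inj.
rewrite -(card_le_eql (inj_card_eq injT)).
by apply: subset_card_le => _ [u bu <-]; apply: transfer_boundary.
Qed.

End Count.

Lemma boundary_le (w xi : latM) (P F : set NQ) (hmin hmax : int)
    (R : int -> set NQ) (ua ub : latN) :
  unimodular xi w -> fano P -> factor_with w P F hmin R ->
  is_hmin w P hmin -> is_hmax w P hmax -> F (toNQ ua) -> F (toNQ ub) ->
  (forall f, F f -> pairingQ xi (toNQ ua) <= pairingQ xi f) ->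
  (forall f, F f -> pairingQ xi f <= pairingQ xi (toNQ ub)) ->
  pairing xi ua = pairing xi ub \/ - hmin <= hmax ->
  (boundary_points P #<= boundary_points (mut_with w P F hmin hmax R))%card.
Proof.
move=> uni fanoP factF minP maxP Fa Fb aP bP wide.
have latP : lattice_polytope P by case: fanoP.
have maxP' : is_hmin (- w) P (- hmax).
  case: maxP => -[x Px wx] xM; split.
    by exists x => //; rewrite !pairQE wx intrN.
  by move=> y /xM; rewrite !pairQE intrN lerN2.
have [ur [Pur wur urM]] := edge_max xi latP minP.
have [ut [Put wut utM]] := edge_max xi latP maxP'.
apply: (transfer_card uni fanoP factF minP maxP Fa Fb aP bP Pur wur urM Put) => //.
  by apply: oppr_inj; rewrite -wut !pairingE !mxE; ring.
by move=> q Pq wq; apply: utM => //; rewrite !pairQE wq.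
Qed.

Theorem lemma3p15 (P : set NQ) (Pfano : fano P) (Psym : symmetric_polygon P) :
  minimal P.
Proof.
move=> Q [w [F [hmin [hmax [R [pw minP maxP factF ->]]]]]].
have [xi uni] := primitive_unimodular pw.
have [latF F0 _] := factF.
(* F lies in a single row, so the ends of its bottom edge are its ends. *)
have flatF : is_hmin w F 0.
  have [x Fx wx] : (pairingQ w @` F) 0 by rewrite F0.
  split; first by exists x.
  by move=> f /(factor_height factF) ->.
have [ua [Fa wa uaM]] := edge_max (- xi) latF flatF.
have [ub [Fb wb ubM]] := edge_max xi latF flatF.
have aP f : F f -> pairingQ xi (toNQ ua) <= pairingQ xi f.
  move=> Ff; have := uaM f Ff; rewrite !(factor_height factF) // => /(_ erefl).
  by rewrite !pairQE lerN2.
have bP f : F f -> pairingQ xi f <= pairingQ xi (toNQ ub).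
  by move=> Ff; apply: ubM => //; rewrite !(factor_height factF).
apply: (boundary_le uni Pfano factF minP maxP Fa Fb aP bP).
exact: (factor_width uni Pfano factF minP maxP Fa Fb aP bP).
Qed.
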